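(* Nontrivial integer solutions $(a,p,q)$ of the Diophantine system $$\begin{cases}(p^2+q^2)^2-a^2=\square,\\ (p^2-q^2)^2-a^2=\square\end{cases}$$ are given by the formulas $$a=k\cdot 4N\sqrt{xz},\qquad p^2=k\cdot (x+N)(z+N),\qquad q^2=k\cdot (x-N)(z-N),$$ where $k$ is an integer and $x$ and $z$ are nontrivial different rational solutions of an arbitrary congruent number equation $C_N$. (The integer $k$ and the solutions $x,z$ must be chosen so that $a$, $p$ and $q$ are integers.)
   Context: The symbol $\square$ denotes a perfect square (not necessarily the same one at each occurrence). For a squarefree positive integer $N$, the congruent number equation is $C_N:\ y^2=x^3-N^2x$. A rational solution $(x,y)$ of $C_N$ is nontrivial if $y\neq 0$; its first coordinate is also called a nontrivial rational solution of $C_N$. Thus $x$ and $z$ are the first coordinates of nontrivial rational solutions of the same equation $C_N$. A solution of the system corresponds to two Pythagorean triangles with common leg $a=a_1=a_2$, other legs $b_1,b_2$ and hypotenuses $c_1=p^2+q^2$, $c_2=p^2-q^2$. The solution is called nontrivial if both Pythagorean triangles exist and they are distinct: $a_1b_1c_1a_2b_2c_2\neq 0$, or, as stated in the notation of the system, $apq\neq 0$ and $p\neq q$.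
   Formalization: With k an integer the formulas miss some nontrivial solutions, e.g. (a,p,q)=(153,21,16); that every nontrivial solution is so given is therefore proved for a scaled triple (m²a, mp, mq) with some integer m>0, i.e. with k rational for (a,p,q) itself. *)

(* Defs.v *)
From mathcomp Require Import all_boot all_order all_algebra.

Set Implicit Arguments.
Unset Strict Implicit.
Unset Printing Implicit Defensive.

Import Order.TTheory GRing.Theory Num.Theory.
Local Open Scope ring_scope.

Definition squarefree (N : nat) : Prop :=
  forall d : nat, (d ^ 2 %| N)%N -> d = 1%N.

(* First coordinate of a rational point of [y^2 = x^3 - N^2 x] with [y != 0]. *)
Definition congruent_sol (N : nat) (x : rat) : Prop :=
  exists2 y : rat, y != 0 & y ^+ 2 = x ^+ 3 - N%:R ^+ 2 * x.

(* The triangles have legs [a, b1] and [a, b2] and (signed) hypotenuses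
   [p^2 + q^2] and [p^2 - q^2].  The two nonvanishing conditions are not
   equivalent: [q = 0] makes the two triangles coincide although
   the long product may be nonzero, while [a = p^2 - q^2] solves both equations
   with [a p q <> 0] and [p <> q] but has [b2 = 0], so that the second triangle
   does not exist. *)
Definition nontrivial_sol (a p q : int) : Prop :=
  exists b1 b2 : int,
    [/\ (p ^+ 2 + q ^+ 2) ^+ 2 - a ^+ 2 = b1 ^+ 2,
        (p ^+ 2 - q ^+ 2) ^+ 2 - a ^+ 2 = b2 ^+ 2,
        a * b1 * (p ^+ 2 + q ^+ 2) * a * b2 * (p ^+ 2 - q ^+ 2) != 0
      & a * p * q != 0 /\ p != q].

(* [r] is either square root of [x z]: since [a] may have either sign, so may
   the root.  It can be taken rational, because [a], [k], [N] are integers and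
   [k], [N] are nonzero; [k = 0] would only give [a = p = q = 0]. *)
Definition given_by_formulas (a p q : int) : Prop :=
  exists (N : nat) (k : int) (x z r : rat),
    [/\ [/\ (0 < N)%N, squarefree N & k != 0],
        [/\ congruent_sol N x, congruent_sol N z & x != z],
        r ^+ 2 = x * z /\ a%:Q = k%:Q * (4%:R * N%:R * r),
        (p ^+ 2)%:Q = k%:Q * ((x + N%:R) * (z + N%:R))
      & (q ^+ 2)%:Q = k%:Q * ((x - N%:R) * (z - N%:R))].

(* Main.v *)
Require Import Defs.
From mathcomp Require Import all_boot all_order all_algebra.
From mathcomp Require Import ring.

Set Implicit Arguments.
Unset Strict Implicit.
Unset Printing Implicit Defensive.

Import Order.TTheory GRing.Theory Num.Theory.
Local Open Scope ring_scope.

(** Both directions rest on the fact that the formulas make each side of the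
system a difference of squares that factors.  With
<<p^2 = k (x+N)(z+N)>>, <<q^2 = k (x-N)(z-N)>> and <<a^2 = 16 k^2 N^2 x z>>,
- <<p^2 + q^2 = 2k(xz + N^2)>>, so <<b1 = 2k(xz - N^2)>>;
- <<p^2 - q^2 = 2kN(x + z)>>, so <<b2 = 2kN(x - z)>>.

From formulas to triangles ([formulas_nontrivial]), what remains is that no
side vanishes.  The sum [x + z] is nonzero because [x z] is a nonzero square.
The product [x z] differs from [N^2] because translation by the 2-torsion point
[(0, 0)] sends [x] to [- N^2 / x]; a point with first coordinate [N^2 / x]
would therefore force a nonzero square to equal the opposite of a square
([congruent_sol_mul_neq]).

From triangles to formulas ([nontrivial_formulas]), solving the relations above
for [x] and [z] gives, with <<c = p^2 - q^2 + b2>>, <<e = p^2 - q^2 - b2>> and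
<<k = p^2 + q^2 - b1>>, the ratios <<x / N = c / k>> and <<z / N = e / k>>.
The number <<N c / k>> is a first coordinate on the congruent number curve of
[N] exactly when [N] is the squarefree part of <<c k (c^2 - k^2)>>, which is up
to sign the area of the right triangle generated by [c] and [k]
([congruent_sol_ratio]).  The two ratios share the same [N], since
<<ce = a^2>>, <<(c+k)(e+k) = 4 p^2 k>> and <<(c-k)(e-k) = 4 q^2 k>> make the
product of the two areas a square.  The area must also be positive, and this is
where the freedom in the sign of [b1] is spent: replacing [b1] by [- b1] flips
the sign of the area ([positive_area_root]).  Finally the relation
<<4 k' N^2 = p^2 + q^2 - b1>> shows that the coefficient [k'] of the formulas
is [k / (4 N^2)]; scaling [p] and [q] by [2 N] turns it into the integer [k]. *)

(** * Squares and squarefree parts *)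

Lemma squarefree_decomposition (M : nat) :
  (0 < M)%N ->
  exists N s : nat, [/\ squarefree N, (0 < N)%N & M = (N * s ^ 2)%N].
Proof.
move=> M_gt0.
pose P s := (s ^ 2 %| M)%N.
have exP : exists s, P s by exists 1%N; rewrite /P exp1n dvd1n.
have P_le s : P s -> (s <= M)%N.
  move=> /(dvdn_leq M_gt0); apply: leq_trans.
  by case: s => // s; rewrite leq_pmulr.
case: (ex_maxnP exP P_le) => s /dvdnP[N defM] s_max.
have /andP[N_gt0 s2_gt0] : (0 < N)%N && (0 < s ^ 2)%N.
  by rewrite -muln_gt0 -defM.
have s_gt0 : (0 < s)%N by rewrite expn_gt0 orbF in s2_gt0.
exists N, s; split=> // d d2_dvd_N.
have /s_max : P (d * s)%N by rewrite /P defM expnMn dvdn_mul.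
rewrite -[leqRHS]mul1n leq_pmul2r // => d_le1.
case: d d2_dvd_N d_le1 => [|[|d]] //.
by rewrite exp0n // dvd0n => /eqP N0; rewrite N0 in N_gt0.
Qed.

Lemma int_squarefree_part (n : int) :
  0 < n ->
  exists (N : nat) (s : rat),
    [/\ squarefree N, (0 < N)%N, s != 0 & n%:~R = N%:R * s ^+ 2].
Proof.
case: n => // n; rewrite ltz_nat => n_gt0.
have [N [s [sfN N_gt0 defn]]] := squarefree_decomposition n_gt0.
exists N, s%:R; split=> //.
  rewrite pnatr_eq0; apply: contraTneq n_gt0 => s0.
  by rewrite defn s0 exp0n // muln0.
by rewrite -pmulrn defn natrM natrX.
Qed.

(** The denominator divides the square of the numerator and is coprime to it. *)
Lemma rat_sqrt_int (w : rat) (n : int) :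
  w ^+ 2 = n%:~R -> exists m : int, w = m%:~R.
Proof.
move=> w2; exists (numq w).
have num2 : numq w ^+ 2 = n * denq w ^+ 2.
  apply: (@intr_inj rat); rewrite rmorphXn rmorphM rmorphXn /= -w2.
  by rewrite numqE exprMn.
have dvd_d2 : (`|denq w| %| `|numq w| ^ 2)%N.
  by rewrite -abszX num2 abszM abszX expnS mulnCA dvdn_mulr.
have d1 : `|denq w|%N = 1%N.
  apply/eqP; rewrite -dvdn1 -(eqP (coprimeXl 2 (coprime_num_den w))).
  by rewrite dvdn_gcd dvd_d2 dvdnn.
by rewrite numqE -[denq w]absz_denq d1 mulr1.
Qed.

(** * Points on congruent number curves *)

Lemma congruent_sol_neq (N : nat) (x : rat) :
  congruent_sol N x -> [/\ x != 0, x + N%:R != 0 & x - N%:R != 0].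
Proof.
case=> y y0 defy.
have : x * (x + N%:R) * (x - N%:R) != 0.
  have -> : x * (x + N%:R) * (x - N%:R) = y ^+ 2 by rewrite defy; ring.
  by rewrite sqrf_eq0.
by rewrite !mulf_eq0 !negb_or => /andP[/andP[]].
Qed.

(** The translate of [(x, y)] by [(0, 0)] is [(- N^2 / x, N^2 y / x^2)].  If
[z = N^2 / x] then the cubic, being odd, takes at [z] the value
[- (N^2 y / x^2)^2], whereas it also equals the square [w^2]. *)
Lemma congruent_sol_mul_neq (N : nat) (x z : rat) :
  congruent_sol N x -> congruent_sol N z -> x * z != N%:R ^+ 2.
Proof.
move=> solx [w w0 defw]; have [x0 _ _] := congruent_sol_neq solx.
case: solx => y y0 defy; apply: contra_neq w0 => xz.
have : (x ^+ 2 * w) ^+ 2 + (N%:R ^+ 2 * y) ^+ 2 = 0.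
  rewrite !exprMn defw defy.
  have -> : x ^+ 2 ^+ 2 * (z ^+ 3 - N%:R ^+ 2 * z)
            = x * (x * z) ^+ 3 - N%:R ^+ 2 * x ^+ 3 * (x * z) by ring.
  by rewrite xz; ring.
move/eqP; rewrite paddr_eq0 ?sqr_ge0 // !sqrf_eq0 => /andP[].
by rewrite mulf_eq0 sqrf_eq0 (negPf x0) => /eqP.
Qed.

(** The classical passage from right triangles to points: for [c > k > 0],
[c k (c^2 - k^2)] is the area of the triangle with legs [2 c k] and
[c^2 - k^2]. *)
Lemma congruent_sol_ratio (N : nat) (c k s : rat) :
    (0 < N)%N -> k != 0 -> s != 0 ->
    c * k * (c ^+ 2 - k ^+ 2) = N%:R * s ^+ 2 ->
  congruent_sol N (N%:R * (c / k)).
Proof.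
move=> N_gt0 k0 s0 area.
have N0 : N%:R != 0 :> rat by rewrite pnatr_eq0 -lt0n.
exists (N%:R ^+ 2 * s / k ^+ 2).
  by rewrite !mulf_neq0 ?invr_eq0 ?expf_neq0.
have -> : (N%:R ^+ 2 * s / k ^+ 2) ^+ 2
          = N%:R ^+ 3 * (N%:R * s ^+ 2) / k ^+ 4 :> rat by field.
by rewrite -area; field.
Qed.

(** * From the formulas to the triangles *)

Lemma formulas_nontrivial (a p q : int) :
  given_by_formulas a p q -> nontrivial_sol a p q.
Proof.
case=> N [k [x [z [r [[N_gt0 _ k0] [solx solz xz]]]]]] [r2 defa] defp defq.
have [x0 xpN xmN] := congruent_sol_neq solx.
have [z0 zpN zmN] := congruent_sol_neq solz.
have xzN := congruent_sol_mul_neq solx solz.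
have N0 : N%:R != 0 :> rat by rewrite pnatr_eq0 -lt0n.
have kQ0 : k%:~R != 0 :> rat by rewrite intr_eq0.
have r0 : r != 0 by rewrite -sqrf_eq0 r2 mulf_neq0.
have xDz : x + z != 0.
  apply: contra_neq r0 => /eqP; rewrite addrC addr_eq0 => /eqP zx.
  have : r ^+ 2 + x ^+ 2 = 0 by rewrite r2 zx; ring.
  by move/eqP; rewrite paddr_eq0 ?sqr_ge0 // !sqrf_eq0 => /andP[/eqP].
have a0 : a != 0 by rewrite -(intr_eq0 rat) defa !mulf_neq0.
have p0 : p != 0 by rewrite -sqrf_eq0 -(intr_eq0 rat) defp !mulf_neq0.
have q0 : q != 0 by rewrite -sqrf_eq0 -(intr_eq0 rat) defq !mulf_neq0.
have diff0 : p ^+ 2 - q ^+ 2 != 0.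
  rewrite -(intr_eq0 rat) rmorphB /= defp defq.
  have -> : k%:~R * ((x + N%:R) * (z + N%:R))
            - k%:~R * ((x - N%:R) * (z - N%:R))
            = k%:~R * (2 * N%:R * (x + z)) by ring.
  by rewrite !mulf_neq0.
have sum0 : p ^+ 2 + q ^+ 2 != 0.
  by rewrite paddr_eq0 ?sqr_ge0 // !sqrf_eq0 negb_and p0.
have [b1 defb1] : exists b1 : int,
    2 * k%:~R * (x * z - N%:R ^+ 2) = b1%:~R.
  (* Since [2 k (x z + N^2) = p^2 + q^2]. *)
  exists (p ^+ 2 + q ^+ 2 - 4 * k * N%:R ^+ 2).
  by rewrite rmorphB rmorphD /= defp defq; ring.
have [b2 defb2] : exists b2 : int, 2 * k%:~R * N%:R * (x - z) = b2%:~R.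
  apply: (@rat_sqrt_int _ ((p ^+ 2 - q ^+ 2) ^+ 2 - a ^+ 2)).
  by rewrite rmorphB !rmorphXn rmorphB /= defp defq defa !exprMn r2; ring.
exists b1, b2; split.
- apply: (@intr_inj rat); rewrite rmorphB !rmorphXn rmorphD /=.
  by rewrite defp defq defa -defb1 !exprMn r2; ring.
- apply: (@intr_inj rat); rewrite rmorphB !rmorphXn rmorphB /=.
  by rewrite defp defq defa -defb2 !exprMn r2; ring.
- have b10 : b1 != 0 by rewrite -(intr_eq0 rat) -defb1 !mulf_neq0 // subr_eq0.
  have b20 : b2 != 0 by rewrite -(intr_eq0 rat) -defb2 !mulf_neq0 // subr_eq0.
  by rewrite !mulf_neq0.
- split; first by rewrite !mulf_neq0.
  by apply: contraNneq diff0 => ->; rewrite subrr.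
Qed.

(** * From the triangles to the formulas *)

(** The areas attached to [b1] and to [- b1] have opposite signs, since their
product is [- (4 c^2 a p q)^2].  Indeed, writing [k] and [k'] for the two values
of [p^2 + q^2 - b], one has [k k' = a^2 = c e] with [e = p^2 - q^2 - b2], and
[(c^2 - k^2)(c^2 - k'^2) = c^2 ((c + e)^2 - (k + k')^2)], where
[c + e = 2(p^2 - q^2)] and [k + k' = 2(p^2 + q^2)]. *)
Lemma positive_area_root (a p q b1 b2 : int) :
    a != 0 -> p != 0 -> q != 0 -> p ^+ 2 - q ^+ 2 + b2 != 0 ->
    (p ^+ 2 + q ^+ 2) ^+ 2 - a ^+ 2 = b1 ^+ 2 ->
    (p ^+ 2 - q ^+ 2) ^+ 2 - a ^+ 2 = b2 ^+ 2 ->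
  exists2 b : int, (p ^+ 2 + q ^+ 2) ^+ 2 - a ^+ 2 = b ^+ 2 &
    let c := p ^+ 2 - q ^+ 2 + b2 in let k := p ^+ 2 + q ^+ 2 - b in
    0 < c * k * (c ^+ 2 - k ^+ 2).
Proof.
move=> a0 p0 q0 c0 eq1 eq2.
pose c := p ^+ 2 - q ^+ 2 + b2.
pose k b := p ^+ 2 + q ^+ 2 - b.
pose area b := c * k b * (c ^+ 2 - k b ^+ 2).
suff : area b1 * area (- b1) < 0.
  case: (ltrP 0 (area b1)) => [pos1 _ | neg1 prod_lt0]; first by exists b1.
  exists (- b1); first by rewrite sqrrN.
  change (0 < area (- b1)).
  by rewrite ltNge; apply: contraTN prod_lt0 => neg2; rewrite -leNgt mulr_le0.
have kk : k b1 * k (- b1) = a ^+ 2 by rewrite /k opprK -subr_sqr -eq1 subKr.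
have ce : c * (p ^+ 2 - q ^+ 2 - b2) = a ^+ 2.
  by rewrite mulrC -subr_sqr -eq2 subKr.
have -> : area b1 * area (- b1) = - (4 * c ^+ 2 * a * p * q) ^+ 2.
  transitivity (c ^+ 2 * a ^+ 2 *
      (c ^+ 4 - c ^+ 2 * (4 * (p ^+ 2 + q ^+ 2) ^+ 2 - 2 * a ^+ 2)
       + a ^+ 2 ^+ 2)).
    by rewrite -kk /area /k; ring.
  have -> : - (4 * c ^+ 2 * a * p * q) ^+ 2
            = c ^+ 2 * a ^+ 2 * - (16 * c ^+ 2 * (p ^+ 2 * q ^+ 2)) by ring.
  by congr (_ * _); rewrite -ce /c; ring.
by rewrite oppr_lt0 lt_def sqr_ge0 sqrf_eq0 !mulf_neq0 // sqrf_eq0.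
Qed.

Lemma nontrivial_formulas (a p q : int) :
  nontrivial_sol a p q ->
  exists m : int, 0 < m /\ given_by_formulas (m ^+ 2 * a) (m * p) (m * q).
Proof.
case=> b1' [b2 [eq1' eq2]]; rewrite !mulf_eq0 !negb_or.
move=> /andP[/andP[_ b20] _] [/andP[/andP[a0 p0] q0] _].
have ce : (p ^+ 2 - q ^+ 2 + b2) * (p ^+ 2 - q ^+ 2 - b2) = a ^+ 2.
  by rewrite mulrC -subr_sqr -eq2 subKr.
have c0 : p ^+ 2 - q ^+ 2 + b2 != 0.
  by apply: contra_neq a0 => c0; apply/eqP; rewrite -sqrf_eq0 -ce c0 mul0r.
have [b1 eq1 /= area_gt0] := positive_area_root a0 p0 q0 c0 eq1' eq2.
have [N [s [sfN N_gt0 s0 areaN]]] := int_squarefree_part area_gt0.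
set c := p ^+ 2 - q ^+ 2 + b2 in ce c0 area_gt0 areaN.
set k := p ^+ 2 + q ^+ 2 - b1 in area_gt0 areaN.
set e := p ^+ 2 - q ^+ 2 - b2 in ce.
have k0 : k != 0 by apply: contraTneq area_gt0 => ->; rewrite mulr0 mul0r.
have c_neq_e : c != e.
  rewrite -subr_eq0; have -> : c - e = b2 *+ 2 by rewrite /c /e; ring.
  by rewrite mulrn_eq0.
have bb : b1 ^+ 2 - b2 ^+ 2 = 4 * p ^+ 2 * q ^+ 2 by rewrite -eq1 -eq2; ring.
have plus : (c + k) * (e + k) = 4 * p ^+ 2 * k.
  transitivity (4 * p ^+ 2 * (p ^+ 2 - b1) + (b1 ^+ 2 - b2 ^+ 2)).
    by rewrite /c /e /k; ring.
  by rewrite bb /k; ring.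
have minus : (c - k) * (e - k) = 4 * q ^+ 2 * k.
  transitivity (4 * q ^+ 2 * (q ^+ 2 - b1) + (b1 ^+ 2 - b2 ^+ 2)).
    by rewrite /c /e /k; ring.
  by rewrite bb /k; ring.
clearbody c k e.
have areas : (c * k * (c ^+ 2 - k ^+ 2)) * (e * k * (e ^+ 2 - k ^+ 2))
             = (4 * a * p * q * k ^+ 2) ^+ 2.
  transitivity (c * e * k ^+ 2 * ((c + k) * (e + k)) * ((c - k) * (e - k))).
    by ring.
  by rewrite ce plus minus; ring.
have N0 : N%:R != 0 :> rat by rewrite pnatr_eq0 -lt0n.
have kQ0 : k%:~R != 0 :> rat by rewrite intr_eq0.
have areaNc : c%:~R * k%:~R * (c%:~R ^+ 2 - k%:~R ^+ 2) = N%:R * s ^+ 2 :> rat.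
  by rewrite -areaN; ring.
(* The cofactor of [N] in the area of [e] is the square of this [t], because the
   product of the two areas is [areas] and that of [c] is [N s^2]. *)
pose t : rat := 4 * a%:~R * p%:~R * q%:~R * k%:~R ^+ 2 / (N%:R * s).
have t0 : t != 0.
  by rewrite !mulf_neq0 ?invr_eq0 ?expf_neq0 ?mulf_neq0 ?intr_eq0.
have areaNe : e%:~R * k%:~R * (e%:~R ^+ 2 - k%:~R ^+ 2) = N%:R * t ^+ 2 :> rat.
  have Ns0 : N%:R * s ^+ 2 != 0 :> rat by rewrite mulf_neq0 ?expf_neq0.
  apply: (mulfI Ns0).
  have -> : N%:R * s ^+ 2 * (N%:R * t ^+ 2)
            = (4 * a%:~R * p%:~R * q%:~R * k%:~R ^+ 2) ^+ 2 :> rat.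
    by rewrite /t; field; rewrite N0 s0.
  have <- : ((4 * a * p * q * k ^+ 2) ^+ 2)%:~R
            = (4 * a%:~R * p%:~R * q%:~R * k%:~R ^+ 2) ^+ 2 :> rat by ring.
  by rewrite -areas -areaN; ring.
exists (2 * N%:R); split; first by rewrite mulr_gt0 // ltr0n.
exists N, k, (N%:R * (c%:~R / k%:~R)), (N%:R * (e%:~R / k%:~R)).
exists (N%:R * (a%:~R / k%:~R)); split.
- by split.
- split; first exact: congruent_sol_ratio areaNc.
    exact: congruent_sol_ratio areaNe.
  by rewrite (inj_eq (mulfI N0)) (inj_eq (mulIf _)) ?invr_eq0 // eqr_int.
- split.
    have ceQ : c%:~R * e%:~R = a%:~R ^+ 2 :> rat.
      by rewrite -intrM ce rmorphXn.
    by rewrite exprMn expr_div_n -ceQ; field.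
  by field.
- have plusQ : (c%:~R + k%:~R) * (e%:~R + k%:~R)
               = 4 * p%:~R ^+ 2 * k%:~R :> rat.
    by rewrite -!intrD -intrM plus; ring.
  have -> : ((2 * N%:R * p) ^+ 2)%:~R
            = N%:R ^+ 2 * (4 * p%:~R ^+ 2 * k%:~R) / k%:~R :> rat by field.
  by rewrite -plusQ; field.
- have minusQ : (c%:~R - k%:~R) * (e%:~R - k%:~R)
                = 4 * q%:~R ^+ 2 * k%:~R :> rat.
    by rewrite -!intrB -intrM minus; ring.
  have -> : ((2 * N%:R * q) ^+ 2)%:~R
            = N%:R ^+ 2 * (4 * q%:~R ^+ 2 * k%:~R) / k%:~R :> rat by field.
  by rewrite -minusQ; field.
Qed.

(* The system is invariant under (a, p, q) |-> (m^2 a, m p, m q); with k an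
   integer the formulas reach every nontrivial solution up to this scaling, and
   only so: 4 k N^2 = p^2 + q^2 -+ b1 is odd for (a, p, q) = (153, 21, 16). *)
Theorem theorem1 :
  (forall a p q : int, given_by_formulas a p q -> nontrivial_sol a p q)
  /\
  (forall a p q : int, nontrivial_sol a p q ->
     exists m : int, 0 < m /\ given_by_formulas (m ^+ 2 * a) (m * p) (m * q)).
Proof.
by split; [exact: formulas_nontrivial | exact: nontrivial_formulas].
Qed.
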